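(* Let $V=\mathbb R^{p,q}\ne0$ and let $S$ be its spinor module. The following vector spaces are isomorphic: the space $\mathcal B$ of $\mathfrak{so}(V)$-invariant bilinear forms on $S$, the space $\mathcal J$ of $\mathfrak{so}(V)$-equivariant linear maps $V^*\to S^*\otimes S^*$, and the space $\mathcal M$ of $\mathfrak{so}(V)$-equivariant multiplications, i.e. $\mathfrak{so}(V)$-equivariant linear maps $V^*\otimes S\to S$. In particular, Clifford multiplication $\rho:V^*\otimes S\to S$ defines an isomorphism $$j_\rho:\mathcal B\to\mathcal J,\qquad j_\rho(\beta)(v^* )=\beta(\rho(v^* )\,\cdot\,,\,\cdot\,),$$ and hence any $\mathfrak{so}(V)$-equivariant embedding $V^*\hookrightarrow S^*\otimes S^*$ is of the form $$j=j_\rho(\beta):v^*\mapsto\beta(\rho(v^* )\,\cdot\,,\,\cdot\,),\qquad \beta\in\mathcal B,\ v^*\in V^*.$$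
   Context: $V=\mathbb R^{p,q}$ is the pseudo-Euclidean space with $p$ positive and $q$ negative squares; $V^*$ is identified with $V$ by the scalar product. $C\ell(V)$ is the Clifford algebra with $v^2=-\langle v,v\rangle$, and the spinor module $S$ is an irreducible real $C\ell(V)$-module, viewed as a module of $\mathfrak{so}(V)\subset C\ell(V)$. $\rho(v)$ denotes the action of $v\in V\subset C\ell(V)$ on $S$ (Clifford multiplication). $S^*\otimes S^*$ is identified with the space of bilinear forms on $S$. *)

(* Defs.v *)
From HB Require Import structures.
From mathcomp Require Import all_boot all_order all_algebra.
From mathcomp Require Import boolp reals.
From mathcomp Require Import lra.

Set Implicit Arguments.
Unset Strict Implicit.
Unset Printing Implicit Defensive.

Import Order.TTheory GRing.Theory Num.Theory.
Local Open Scope ring_scope.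

Section PseudoEuclidean.
Variables (R : realType) (p q : nat).

Definition sgn_pq (i : 'I_(p + q)) : R := if (i < p)%N then 1 else -1.

Definition sprod (u v : 'cV[R]_(p + q)) : R :=
  \sum_i sgn_pq i * (u i 0 * v i 0).

Definition so (A : 'M[R]_(p + q)) : Prop :=
  forall u v, sprod (A *m u) v + sprod u (A *m v) = 0.

Definition basisV (i : 'I_(p + q)) : 'cV[R]_(p + q) := delta_mx i 0.

Lemma sprodC u v : sprod u v = sprod v u.
Proof. by apply: eq_bigr => i _; rewrite (mulrC (u i 0)). Qed.

Lemma sprodDr u v w : sprod u (v + w) = sprod u v + sprod u w.
Proof.
rewrite -big_split; apply: eq_bigr => i _ /=.
by rewrite mxE !mulrDr.
Qed.

Lemma sprod_basis i v : sprod (basisV i) v = sgn_pq i * v i 0.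
Proof.
rewrite /sprod (bigD1 i) //= big1 => [|j ne_ji].
  by rewrite mxE !eqxx mul1r addr0.
by rewrite mxE (negPf ne_ji) mul0r mulr0.
Qed.

Lemma sgn_pq_sq i : sgn_pq i * sgn_pq i = 1.
Proof. by rewrite /sgn_pq; case: ifP; rewrite ?mulrNN mulr1. Qed.

Lemma basisV_sum (v : 'cV[R]_(p + q)) : v = \sum_i v i 0 *: basisV i.
Proof.
apply/matrixP => k z; rewrite (ord1 z) summxE (bigD1 k) //= big1 => [|j ne_jk].
  by rewrite !mxE !eqxx mulr1 addr0.
by rewrite !mxE eq_sym (negPf ne_jk) mulr0.
Qed.

End PseudoEuclidean.

Section Clifford.
Variables (R : realType) (p q : nat).
Local Notation V := 'cV[R]_(p + q).

Definition clifford_map (A : algType R) (f : V -> A) : Prop :=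
  forall v, f v * f v = (- sprod v v)%:A.

(* Cl(V) is given by its universal property, hence up to isomorphism. *)
Definition clifford_algebra (C : algType R) (iota : {linear V -> C}) : Prop :=
  clifford_map iota /\
  forall (A : algType R) (f : {linear V -> A}), clifford_map f ->
    exists phi : {lrmorphism C -> A},
      (forall v, phi (iota v) = f v) /\
      (forall psi : {lrmorphism C -> A}, (forall v, psi (iota v) = f v) ->
         forall x, psi x = phi x).

Variables (C : algType R) (iota : {linear V -> C}).

(* The inclusion of so(V) in Cl(V): A goes to the element of the span of the
   commutators [u, v], u, v in V, whose commutator with v in V is A v.
   Lemma so_clE checks the latter, Lemma so_cl_comm the former. *)
Definition so_cl (A : 'M[R]_(p + q)) : C :=
  4^-1 *: \sum_i sgn_pq R i *: (iota (basisV R i) * iota (A *m basisV R i)).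

Lemma clifford_comm : clifford_map iota -> forall u v,
  iota u * iota v + iota v * iota u = (- (2 * sprod u v))%:A.
Proof.
move=> Ci u v; have := Ci (u + v).
rewrite linearD mulrDl !mulrDr !Ci !sprodDr.
rewrite (sprodC (u + v) u) (sprodC (u + v) v) !sprodDr (sprodC v u).
set a := iota u * iota v; set b := iota v * iota u => E.
have -> : a + b = ((- sprod u u)%:A + a + (b + (- sprod v v)%:A))
                  - (- sprod u u)%:A - (- sprod v v)%:A.
  rewrite [_ + a]addrC -!addrA; congr (_ + _).
  by rewrite addrCA -opprD (addrA _ _ (- _)) subrr addr0.
by rewrite E -!scalerBl; congr (_ *: _); lra.
Qed.

Lemma so_cl_comm : clifford_map iota -> forall A, so A ->
  so_cl A = 8^-1 *: \sum_i sgn_pq R i *: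
    (iota (basisV R i) * iota (A *m basisV R i)
     - iota (A *m basisV R i) * iota (basisV R i)).
Proof.
move=> Ci A soA; rewrite /so_cl; set F := (X in _ = _ *: X).
have -> : F = 2 *: \sum_i sgn_pq R i *:
    (iota (basisV R i) * iota (A *m basisV R i)).
  rewrite scaler_sumr; apply: eq_bigr => i _.
  rewrite scalerA mulrC -scalerA; congr (_ *: _).
  set e := basisV R i; have e0 : sprod e (A *m e) = 0.
    have := soA e e; rewrite sprodC -mulr2n => /eqP.
    by rewrite mulrn_eq0 => /eqP.
  have := clifford_comm Ci e (A *m e); rewrite e0 mulr0 oppr0 scale0r.
  by move/eqP; rewrite addr_eq0 => /eqP ->; rewrite -mulr2n scaler_nat.
by rewrite scalerA; congr (_ *: _); lra.
Qed.

Lemma so_clE : clifford_map iota -> forall A, so A ->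
  forall v, so_cl A * iota v - iota v * so_cl A = iota (A *m v).
Proof.
move=> Ci A soA v.
have E (e w : V) : iota e * iota w * iota v - iota v * (iota e * iota w) =
    2 *: (sprod e v *: iota w - sprod w v *: iota e).
  have -> : iota v * (iota e * iota w) =
      (- (2 * sprod e v))%:A * iota w - iota e * (iota v * iota w).
    by rewrite -(clifford_comm Ci) mulrDl !mulrA addrC addKr.
  have -> : iota v * iota w = (- (2 * sprod w v))%:A - iota w * iota v.
    by rewrite -(clifford_comm Ci) addrC addKr.
  rewrite mulrBr -scalerAl mul1r -scalerAr mulr1 mulrA.
  rewrite scalerBr !scalerA !scaleNr.
  rewrite !opprD !opprK addrA [_ * iota v + _]addrC -!addrA.
  by congr (_ + _); rewrite addrCA subrr addr0.
rewrite /so_cl -scalerAl -scalerAr -scalerBr mulr_suml mulr_sumr -sumrB.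
have -> : \sum_i (sgn_pq R i *: (iota (basisV R i) * iota (A *m basisV R i)) * iota v
   - iota v * (sgn_pq R i *: (iota (basisV R i) * iota (A *m basisV R i))))
   = \sum_i 2 *: (iota (A *m (v i 0 *: basisV R i))
                   + iota ((A *m v) i 0 *: basisV R i)).
  apply: eq_bigr => i _; rewrite -scalerAl -scalerAr -scalerBr E.
  have /eqP := soA (basisV R i) v; rewrite addr_eq0 => /eqP ->.
  rewrite !sprod_basis scaleNr opprK scalerA mulrC -scalerA scalerDr !scalerA.
  rewrite !mulrA -!(mulrA 2 _ (sgn_pq _ _)) !sgn_pq_sq mulr1.
  by rewrite -scalemxAr !linearZ /= scalerDr !scalerA.
rewrite -scaler_sumr big_split /= -(raddf_sum iota) -mulmx_sumr -basisV_sum.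
rewrite -(raddf_sum iota) -basisV_sum.
by rewrite -mulr2n -scaler_nat !scalerA -[RHS]scale1r; congr (_ *: _); lra.
Qed.

Variables (S : vectType R) (pi : {linear C -> 'End(S)}).

Definition cl_module : Prop :=
  pi 1 = \1%VF /\ forall x y, pi (x * y) = (pi x \o pi y)%VF.

Definition cl_irreducible : Prop :=
  (fullv : {vspace S}) != 0%VS /\
  forall U : {vspace S}, (forall x, (pi x @: U <= U)%VS) ->
    U = 0%VS \/ U = fullv.

Definition spinor_module : Prop := cl_module /\ cl_irreducible.

Definition clmul (v : V) : 'End(S) := pi (iota v).

Definition so_act (A : 'M[R]_(p + q)) : 'End(S) := pi (so_cl A).

(* Bilinear forms on S in curried form: beta s t is the value of beta. *)
Definition bilform : vectType R := 'Hom(S, 'Hom(S, R^o)).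

Definition inv_bilform : {pred bilform} := [pred b : bilform |
  `[< forall A, so A -> forall s t,
        b (so_act A s) t + b s (so_act A t) = 0 >]].

(* The action of so(V) on a bilinear form b is
   (A b) s t = - (b (A s) t + b s (A t)). *)
Definition equiv_bilform : {pred 'Hom(V, bilform)} :=
  [pred j : 'Hom(V, bilform) |
  `[< forall A, so A -> forall v s t,
        j (A *m v) s t = - (j v (so_act A s) t + j v s (so_act A t)) >]].

(* Linear maps V (x) S -> S in curried form. *)
Definition equiv_mul : {pred 'Hom(V, 'End(S))} := [pred m : 'Hom(V, 'End(S)) |
  `[< forall A, so A -> forall v s,
        so_act A (m v s) = m (A *m v) s + m v (so_act A s) >]].

Fact inv_bilform_submod : submod_closed inv_bilform.
Proof.
split=> [|a b c].
  by apply/asboolP => A _ s t; rewrite !zero_lfunE addr0.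
move=> /asboolP bP /asboolP cP; apply/asboolP => A soA s t.
by rewrite !add_lfunE !scale_lfunE addrACA -scalerDr bP ?cP ?scaler0 ?addr0.
Qed.

Fact equiv_bilform_submod : submod_closed equiv_bilform.
Proof.
split=> [|a b c].
  by apply/asboolP => A _ v s t; rewrite !zero_lfunE addr0 oppr0.
move=> /asboolP bP /asboolP cP; apply/asboolP => A soA v s t.
rewrite !add_lfunE !scale_lfunE.
by rewrite bP // cP // scalerN -opprD addrACA -scalerDr.
Qed.

Fact equiv_mul_submod : submod_closed equiv_mul.
Proof.
split=> [|a b c].
  by apply/asboolP => A _ v s; rewrite !zero_lfunE linear0 addr0.
move=> /asboolP bP /asboolP cP; apply/asboolP => A soA v s.
rewrite !add_lfunE !scale_lfunE linearP /= bP // cP //.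
by rewrite scalerDr addrACA.
Qed.

HB.instance Definition _ :=
  GRing.isSubmodClosed.Build R bilform inv_bilform inv_bilform_submod.
HB.instance Definition _ :=
  GRing.isSubmodClosed.Build R 'Hom(V, bilform) equiv_bilform
    equiv_bilform_submod.
HB.instance Definition _ :=
  GRing.isSubmodClosed.Build R 'Hom(V, 'End(S)) equiv_mul equiv_mul_submod.

(* The vector spaces B, J and M. *)
Definition spaceB := {b : bilform | b \in inv_bilform}.
Definition spaceJ := {j : 'Hom(V, bilform) | j \in equiv_bilform}.
Definition spaceM := {m : 'Hom(V, 'End(S)) | m \in equiv_mul}.

HB.instance Definition _ := Choice.on spaceB.
HB.instance Definition _ := SubChoice.on spaceB.
HB.instance Definition _ := [SubChoice_isSubLmodule of spaceB by <:].
HB.instance Definition _ := Choice.on spaceJ.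
HB.instance Definition _ := SubChoice.on spaceJ.
HB.instance Definition _ := [SubChoice_isSubLmodule of spaceJ by <:].
HB.instance Definition _ := Choice.on spaceM.
HB.instance Definition _ := SubChoice.on spaceM.
HB.instance Definition _ := [SubChoice_isSubLmodule of spaceM by <:].

End Clifford.

Definition lin_isomorphic (R : realType) (U W : lmodType R) : Prop :=
  exists f : {linear U -> W}, bijective f.

(* Main.v *)
Require Import Defs.
From HB Require Import structures.
From mathcomp Require Import all_boot all_order all_algebra.
From mathcomp Require Import boolp reals ring lra.

Set Implicit Arguments.
Unset Strict Implicit.
Unset Printing Implicit Defensive.

Import Order.TTheory GRing.Theory Num.Theory.
Local Open Scope ring_scope.

(** Write e_i for the orthonormal basis of V and eps_i for the sign of
    <e_i, e_i>, so that e_i^2 = - eps_i in Cl(V).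

    The map j_rho : B -> J is injective because Clifford multiplication by one
    e_i is invertible. It is onto: let j be equivariant and let a = e_i e_k
    with i <> k, which is twice an element of so(V). Since a^2 is a scalar
    c = +1 or -1, and bracketing twice with a multiplies e_i by 4 c,
    equivariance forces a to be self-adjoint for the form j(e_i), whence
    j(e_i)(a s, t) = - eps_i j(e_k)(s, t) (equiv_bilform_basis). Therefore the
    form beta(s, t) = - eps_i j(e_i)(e_i s, t), for one fixed i, satisfies
    j(v)(s, t) = beta(v s, t) for every basis vector v, and then for every v
    (unmulformK). Its invariance follows from the equivariance of j
    (unmulform_inv).

    The spaces J and M are isomorphic because S carries a nondegenerate
    invariant form b (inv_bilform_exists), which identifies S with its dual.
    To build b, average a positive definite form over the e_i, so that each of
    them preserves it, and compose its first argument with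
    the product of the e_i that have eps_i = 1. This makes all Clifford
    multiplications self-adjoint, or all of them skew-adjoint; in both cases
    the commutators [u, v], hence so(V), act by skew-adjoint operators. *)

(** * Linear maps and bilinear forms *)

Lemma linfunE (R : realType) (U W : vectType R) (f : U -> W) :
  linear f -> forall u, linfun f u = f u.
Proof.
move=> lf u.
pose g : {linear U -> W} := HB.pack f (GRing.isLinear.Build R U W *:%R f lf).
exact: (lfunE g u).
Qed.

Lemma bilform_exists (R : realType) (S : vectType R) (B : S -> S -> R^o) :
  (forall s, linear (B s)) -> (forall t, linear (B^~ t)) ->
  exists b : bilform S, forall s t, b s t = B s t.
Proof.
move=> lr ll; exists (linfun (fun s => linfun (B s))) => s t.
rewrite linfunE ?linfunE // => a x y; apply/lfunP => z.
by rewrite add_lfunE scale_lfunE !linfunE // ll.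
Qed.

(** A linear map F of the ambient modules and a map G that restrict to mutually
    inverse maps between two submodules give a linear bijection of these. *)
Lemma sub_lin_bij (R : realType) (V W : lmodType R) (P : pred V) (Q : pred W)
    (X : subLmodType P) (Y : subLmodType Q) (F : V -> W) (G : W -> V) :
  linear F ->
  (forall x, P x -> Q (F x)) -> (forall y, Q y -> P (G y)) ->
  (forall x, P x -> G (F x) = x) -> (forall y, Q y -> F (G y) = y) ->
  exists f : {linear X -> Y}, bijective f /\ forall x, val (f x) = F (val x).
Proof.
move=> lF PQ QP FK GK.
pose f (x : X) : Y := Sub (F (val x)) (PQ _ (valP x)).
have lf : linear f.
  by move=> a x y; apply: val_inj; rewrite linearP /= !SubK linearP lF.
exists (HB.pack f (GRing.isLinear.Build R X Y *:%R f lf) : {linear X -> Y}).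
split=> [|x]; last by rewrite /= SubK.
exists (fun y : Y => Sub (G (val y)) (QP _ (valP y)) : X) => x /=;
  by apply: val_inj; rewrite /f !SubK ?FK ?GK //; exact: valP.
Qed.

(** * The orthonormal basis and its infinitesimal rotations *)

Section Basis.
Variables (R : realType) (p q : nat).
Local Notation V := 'cV[R]_(p + q).
Local Notation sgn := (sgn_pq R).
Local Notation e := (basisV R).

Lemma sprodZr (u v : V) a : sprod u (a *: v) = a * sprod u v.
Proof.
by rewrite /sprod mulr_sumr; apply: eq_bigr => i _; rewrite mxE; ring.
Qed.

Lemma sprod_basis2 (i j : 'I_(p + q)) : sprod (e i) (e j) = sgn i *+ (i == j).
Proof. by rewrite sprod_basis mxE eqxx andbT mulr_natr. Qed.

(** The element e_i /\ e_j of so(V): the infinitesimal rotation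
    u |-> <e_i, u> e_j - <e_j, u> e_i of the plane of e_i and e_j. *)
Definition rot (i j : 'I_(p + q)) : 'M[R]_(p + q) :=
  sgn i *: delta_mx j i - sgn j *: delta_mx i j.

Lemma rotE i j (u : V) :
  rot i j *m u = sprod (e i) u *: e j - sprod (e j) u *: e i.
Proof.
have D (k l : 'I_(p + q)) : delta_mx k l *m u = u l 0 *: e k.
  apply/matrixP => x z; rewrite (ord1 z) !mxE (bigD1 l) //= big1 => [|y ne_yl].
    by rewrite !mxE !eqxx andbT addr0 mulrC.
  by rewrite mxE (negPf ne_yl) andbF mul0r.
by rewrite mulmxBl -!scalemxAl !D !scalerA !sprod_basis.
Qed.

Lemma so_rot i j : so (rot i j).
Proof.
move=> u v; rewrite (sprodC _ v) !rotE -!scaleNr !sprodDr !sprodZr.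
rewrite (sprodC v (e j)) (sprodC v (e i)) (sprodC u (e j)) (sprodC u (e i)).
by ring.
Qed.

End Basis.

Section Module.
Variables (R : realType) (p q : nat).
Variables (C : algType R) (iota : {linear 'cV[R]_(p + q) -> C}).
Hypothesis hC : clifford_map iota.
Variables (S : vectType R) (pi : {linear C -> 'End(S)}).
Hypothesis hS : cl_module pi.
Local Notation V := 'cV[R]_(p + q).
Local Notation sgn := (sgn_pq R).
Local Notation e := (basisV R).
Local Notation rho := (clmul iota pi).
Local Notation act := (so_act iota pi).

(** * Clifford multiplication *)

Lemma cl1E s : pi 1 s = s. Proof. by rewrite hS.1 id_lfunE. Qed.

Lemma clME x y s : pi (x * y) s = pi x (pi y s).
Proof. by rewrite hS.2 comp_lfunE. Qed.

Lemma clmul_lin : linear rho.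
Proof. by move=> a u v; rewrite /clmul !linearP. Qed.

Lemma clmulP a u v s : rho (a *: u + v) s = a *: rho u s + rho v s.
Proof. by rewrite clmul_lin add_lfunE scale_lfunE. Qed.

Lemma clmul_sum v s : rho v s = \sum_i v i 0 *: rho (e i) s.
Proof.
rewrite {1}[v]basisV_sum /clmul !linear_sum sum_lfunE; apply: eq_bigr => i _.
by rewrite !linearZ scale_lfunE.
Qed.

Lemma clmul_anticomm u v s :
  rho u (rho v s) + rho v (rho u s) = - (2 * sprod u v) *: s.
Proof.
rewrite /clmul -!clME -add_lfunE -linearD (clifford_comm hC).
by rewrite linearZ scale_lfunE cl1E.
Qed.

Lemma clmul_basis_anticomm i j s : i != j ->
  rho (e i) (rho (e j) s) = - rho (e j) (rho (e i) s).
Proof.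
move=> ne_ij; apply/eqP; rewrite -addr_eq0 clmul_anticomm sprod_basis2.
by rewrite (negPf ne_ij) mulr0n mulr0 oppr0 scale0r.
Qed.

Lemma clmul_basis_sq i s : rho (e i) (rho (e i) s) = - sgn i *: s.
Proof.
have := clmul_anticomm (e i) (e i) s; rewrite sprod_basis2 eqxx mulr1n.
rewrite -mulr2n -scaler_nat => /(congr1 (fun x => 2^-1 *: x)).
by rewrite !scalerA mulVf ?pnatr_eq0 // scale1r => ->; congr (_ *: _); field.
Qed.

Lemma so_act_clmul A v s : so A ->
  act A (rho v s) = rho (A *m v) s + rho v (act A s).
Proof.
move=> soA; apply/eqP; rewrite -subr_eq; apply/eqP.
rewrite /so_act /clmul -(so_clE hC soA) -!clME linearB.
by rewrite add_lfunE opp_lfunE.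
Qed.

(** Under the inclusion of so(V) in Cl(V), e_i /\ e_j is e_i e_j / 2. *)
Lemma so_act_rot i j s : i != j ->
  2 *: act (rot R i j) s = rho (e i) (rho (e j) s).
Proof.
move=> ne_ij; have anti : iota (e j) * iota (e i) = - (iota (e i) * iota (e j)).
  apply/eqP; rewrite -addr_eq0 addrC (clifford_comm hC) sprod_basis2.
  by rewrite (negPf ne_ij) mulr0n mulr0 oppr0 scale0r.
have -> : act (rot R i j) s = 2^-1 *: rho (e i) (rho (e j) s).
  rewrite /so_act /clmul -clME -scale_lfunE -linearZ; congr (pi _ s).
  rewrite /so_cl (bigD1 i) // (bigD1 j) 1?eq_sym //= big1 => [|k /andP[ki kj]].
    rewrite !rotE !sprod_basis2 !eqxx eq_sym (negPf ne_ij) !mulr1n !mulr0n.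
    rewrite !scale0r subr0 sub0r -scaleNr !linearZ /= -!scalerAr anti.
    rewrite scalerN scaleNr opprK !scalerA !sgn_pq_sq !scale1r addr0 -mulr2n.
    by rewrite -scaler_nat scalerA; congr (_ *: _); field.
  rewrite rotE !sprod_basis2 eq_sym (negPf ki) eq_sym (negPf kj) !mulr0n.
  by rewrite !scale0r subr0 linear0 mulr0 scaler0.
by rewrite scalerA divff ?pnatr_eq0 // scale1r.
Qed.

(** * Invariant forms and equivariant maps to forms *)

(** The map j_rho on all bilinear forms: v |-> b(rho(v) _, _). *)
Definition mulform (b : bilform S) : 'Hom(V, bilform S) :=
  linfun (fun v => (b \o rho v)%VF).

Lemma mulformE b v s t : mulform b v s t = b (rho v s) t.
Proof.
rewrite linfunE ?comp_lfunE // => a u w; apply/lfunP => x.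
by rewrite add_lfunE scale_lfunE !comp_lfunE clmulP linearP.
Qed.

Lemma bilform_eq (b c : bilform S) : (forall s t, b s t = c s t) -> b = c.
Proof. by move=> bc; apply/lfunP => s; apply/lfunP => t. Qed.

Lemma homform_eq (j k : 'Hom(V, bilform S)) :
  (forall v s t, j v s t = k v s t) -> j = k.
Proof. by move=> jk; apply/lfunP => v; apply: bilform_eq. Qed.

Lemma mulform_lin : linear mulform.
Proof.
move=> a b c; apply: homform_eq => v s t.
by rewrite !(add_lfunE, scale_lfunE, mulformE).
Qed.

Lemma mulform_equiv b :
  b \in inv_bilform iota pi -> mulform b \in equiv_bilform iota pi.
Proof.
move=> /asboolP bI; apply/asboolP => A soA v s t; rewrite !mulformE.
have -> : rho (A *m v) s = act A (rho v s) - rho v (act A s).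
  by rewrite so_act_clmul // addrK.
have /eqP := bI A soA (rho v s) t; rewrite addr_eq0 => /eqP E.
by rewrite linearB add_lfunE opp_lfunE E opprD addrC.
Qed.

Lemma equiv_bilform_rot (j : 'Hom(V, bilform S)) :
  j \in equiv_bilform iota pi -> forall i k v s t, i != k ->
  j v (rho (e i) (rho (e k) s)) t + j v s (rho (e i) (rho (e k) t)) =
  - 2 * j (rot R i k *m v) s t.
Proof.
move=> /asboolP jE i k v s t ne_ik; rewrite -!so_act_rot // jE //;
  last exact: so_rot.
by rewrite !linearZ /= scale_lfunE /GRing.scale /=; ring.
Qed.

(** The identity that determines j from j(e_i). With a = e_i e_k and a^2 = c,
    applying the equivariance of j twice (Ei, then Ek) gives
    j(e_i)(a s, a t) = c j(e_i)(s, t), that is, a is self-adjoint for j(e_i);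
    then Ei alone computes j(e_k). *)
Lemma equiv_bilform_basis (j : 'Hom(V, bilform S)) :
  j \in equiv_bilform iota pi -> forall i k s t, i != k ->
  j (e i) (rho (e i) (rho (e k) s)) t = - sgn i * j (e k) s t.
Proof.
move=> jE i k s t ne_ik; set a := fun x => rho (e i) (rho (e k) x).
have Ei x y : j (e i) (a x) y + j (e i) x (a y) = - (2 * sgn i) * j (e k) x y.
  rewrite equiv_bilform_rot // rotE !sprod_basis2 eqxx eq_sym (negPf ne_ik).
  by rewrite scale0r subr0 linearZ /= !scale_lfunE /GRing.scale /=; ring.
have Ek x y : j (e k) (a x) y + j (e k) x (a y) = 2 * sgn k * j (e i) x y.
  rewrite equiv_bilform_rot // rotE !sprod_basis2 eqxx (negPf ne_ik).
  rewrite scale0r sub0r linearN linearZ /= opp_lfunE scale_lfunE opp_lfunE.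
  by rewrite scale_lfunE /GRing.scale /=; ring.
pose c : R := - (sgn i * sgn k).
have cc : c * c = 1.
  by rewrite /c mulrNN mulrACA !sgn_pq_sq mulr1.
have aa x : a (a x) = c *: x.
  rewrite /a clmul_basis_anticomm // clmul_basis_sq linearZ /= clmul_basis_sq.
  by rewrite scalerA -scaleNr; congr (_ *: _); rewrite /c; ring.
have adj x y : j (e i) (a x) (a y) = c * j (e i) x y.
  have := Ei (a x) y; have := Ei x (a y); have := Ek x y.
  rewrite !aa !linearZ /= scale_lfunE /GRing.scale /= => Ekxy E1 E2.
  rewrite /c in E1 E2 *; nra.
have sym x y : j (e i) x (a y) = j (e i) (a x) y.
  have := adj (a x) y; rewrite aa linearZ /= scale_lfunE /GRing.scale /=.
  by move=> /(congr1 (fun z => c * z)); rewrite !mulrA cc !mul1r.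
by have := Ei s t; rewrite sym; lra.
Qed.

(** The inverse of j_rho, read off from the value of j at the basis vector e_i:
    the operator - eps_i rho(e_i) is the inverse of rho(e_i). *)
Definition unmulform (i : 'I_(p + q)) (j : 'Hom(V, bilform S)) : bilform S :=
  (- sgn i *: (j (e i) \o rho (e i)))%VF.

Lemma unmulformE i j s t :
  unmulform i j s t = - sgn i * j (e i) (rho (e i) s) t.
Proof. by rewrite !scale_lfunE comp_lfunE. Qed.

Lemma mulformK i b : unmulform i (mulform b) = b.
Proof.
apply: bilform_eq => s t; rewrite unmulformE mulformE clmul_basis_sq linearZ /=.
by rewrite scale_lfunE /GRing.scale /= mulrA mulrNN sgn_pq_sq mul1r.
Qed.

Lemma unmulformK i j :
  j \in equiv_bilform iota pi -> mulform (unmulform i j) = j.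
Proof.
move=> jE; apply: homform_eq => v s t; rewrite mulformE.
have B k : unmulform i j (rho (e k) s) t = j (e k) s t.
  rewrite unmulformE; have [<-|ne_ik] := eqVneq i k.
    rewrite clmul_basis_sq linearZ /= scale_lfunE /GRing.scale /=.
    by rewrite mulrA mulrNN sgn_pq_sq mul1r.
  by rewrite equiv_bilform_basis // mulrA mulrNN sgn_pq_sq mul1r.
rewrite -mulformE [v]basisV_sum !linear_sum !sum_lfunE; apply: eq_bigr => k _.
by rewrite !linearZ !scale_lfunE mulformE B.
Qed.

(** With b the form unmulform i j, equivariance of j = mulform b at e_i yields
    b(A (e_i s), t) + b(e_i s, A t) = 0, and rho(e_i) is onto. *)
Lemma unmulform_inv i j :
  j \in equiv_bilform iota pi -> unmulform i j \in inv_bilform iota pi.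
Proof.
move=> jE; set b := unmulform i j; have jb := unmulformK i jE.
apply/asboolP => A soA s t; pose s' := - sgn i *: rho (e i) s.
have -> : s = rho (e i) s'.
  by rewrite linearZ /= clmul_basis_sq scalerA mulrNN sgn_pq_sq scale1r.
have /asboolP/(_ A soA (e i) s' t) := jE; rewrite -jb !mulformE -/b.
rewrite so_act_clmul // [b (_ + _)]linearD add_lfunE => ->.
by rewrite -addrA addNr.
Qed.


(** * A nondegenerate invariant form *)

Lemma clmul_basis_eq0 i s : rho (e i) s = 0 -> s = 0.
Proof.
move=> s0; have := clmul_basis_sq i s; rewrite s0 linear0 => /esym/eqP.
rewrite scaler_eq0 oppr_eq0 => /orP[/eqP z|/eqP //].
by have := sgn_pq_sq R i; rewrite z mul0r => /esym/eqP; rewrite oner_eq0.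
Qed.

Lemma posdef_exists : exists b : bilform S, forall s, s != 0 -> 0 < b s s.
Proof.
pose x k s := coord (vbasis {:S}) k s.
have [||b bE] := @bilform_exists R S (fun s t => \sum_k x k s * x k t).
- move=> s a u v; rewrite /GRing.scale /= mulr_sumr -big_split.
  by apply: eq_bigr => k _; rewrite /x linearP /=; ring.
- move=> t a u v; rewrite /GRing.scale /= mulr_sumr -big_split.
  by apply: eq_bigr => k _; rewrite /x linearP /=; ring.
have sq_ge0 s k : true -> 0 <= x k s * x k s by rewrite -expr2 sqr_ge0.
exists b => s; apply: contraNT; rewrite -leNgt bE => le0.
have /eqP/psumr_eq0P E0 : \sum_k x k s * x k s == 0.
  by rewrite eq_le le0 sumr_ge0 // => k; apply: sq_ge0.
rewrite (coord_vbasis (memvf s)) big1 // => k _.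
have /eqP := E0 (sq_ge0 s) k isT; rewrite mulf_eq0 orbb => /eqP.
by rewrite -/(x k s) => ->; rewrite scale0r.
Qed.

(** The average of a positive definite form over the finite group generated by
    the e_i, computed one generator at a time: adding the pullback by e_i makes
    the form e_i-invariant, since e_i^2 = +1 or -1, and keeps its invariance
    under the previous e_k, since e_i and e_k anticommute. *)
Lemma posdef_invariant_exists : exists b : bilform S,
  (forall s, s != 0 -> 0 < b s s) /\
  forall i s t, b (rho (e i) s) (rho (e i) t) = b s t.
Proof.
suff [b [b_gt0 bI]] : exists b : bilform S, (forall s, s != 0 -> 0 < b s s) /\
    forall i, i \in enum 'I_(p + q) ->
      forall s t, b (rho (e i) s) (rho (e i) t) = b s t.
  by exists b; split=> // i s t; rewrite bI ?mem_enum.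
elim: (enum _) => [|i r [b [b_gt0 bI]]].
  by have [b b_gt0] := posdef_exists; exists b.
have [||c cE] := @bilform_exists R S
  (fun s t => b s t + b (rho (e i) s) (rho (e i) t)).
- by move=> s a u v; rewrite !linearP scalerDr addrACA.
- move=> t a u v; rewrite !linearP !add_lfunE !scale_lfunE.
  by rewrite scalerDr addrACA.
exists c; split=> [s s_neq0|k kr s t]; rewrite !cE.
  by rewrite addr_gt0 ?b_gt0 //; apply: contra_neq s_neq0;
    apply: clmul_basis_eq0.
have [->|ne_ik] := eqVneq i k.
  rewrite !clmul_basis_sq !linearZ /= scale_lfunE !scalerA mulrNN sgn_pq_sq.
  by rewrite scale1r addrC.
have {}kr : k \in r by move: kr; rewrite inE eq_sym (negPf ne_ik).
rewrite !(clmul_basis_anticomm _ ne_ik) !linearN /= opp_lfunE.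
by rewrite opprK !(bI k).
Qed.

(** H is the product of the e_i with eps_i = 1. Moving e_i across it gives the
    sign (-1)^(p-1) if eps_i = 1 and (-1)^p otherwise, that is k eps_i with
    k = (-1)^(p-1). *)
Lemma twist_exists : exists (H : 'End(S)) (k : R),
  [/\ k * k = 1, forall s, H s = 0 -> s = 0 &
      forall i s, H (rho (e i) s) = (k * sgn i) *: rho (e i) (H s)].
Proof.
pose c (r : seq 'I_(p + q)) i : R :=
  (-1) ^+ size r * (if i \in r then -1 else 1).
have [H H0 HE] : exists2 H : 'End(S), forall s, H s = 0 -> s = 0 &
    forall i s, H (rho (e i) s) =
      c [seq i : 'I_(p + q) <- enum 'I_(p + q) | (i < p)%N] i *:
        rho (e i) (H s).
  have : uniq [seq i : 'I_(p + q) <- enum 'I_(p + q) | (i < p)%N].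
    by rewrite filter_uniq ?enum_uniq.
  elim: [seq _ <- _ | _] => [_|k r IH /= /andP[kr /IH[H H0 HE]]].
    exists \1%VF => [s|i s]; rewrite !id_lfunE //.
    by rewrite /c expr0 mul1r scale1r.
  exists (rho (e k) \o H)%VF => [s|i s]; rewrite !comp_lfunE.
    by move/clmul_basis_eq0/H0.
  rewrite HE linearZ /= /c inE /= exprS; have [->|ne_ik] := eqVneq i k.
    by rewrite (negPf kr) /=; congr (_ *: _); ring.
  rewrite /= clmul_basis_anticomm 1?eq_sym // scalerN -scaleNr.
  by congr (_ *: _); ring.
set r := [seq _ <- _ | _] in HE; exists H, (- (-1) ^+ size r).
split=> // [|i s].
  by rewrite mulrNN -expr2 -exprM mulnC exprM sqrrN !expr1n.
rewrite HE /c mem_filter mem_enum andbT /sgn_pq; congr (_ *: _).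
by case: ifP => _; ring.
Qed.

(** The action of A in terms of commutators, which makes it evidently
    skew-adjoint for a form with rho(v)^* = k rho(v), k^2 = 1. *)
Lemma so_actE A s : so A -> act A s = 8^-1 *: \sum_i sgn i *:
  (rho (e i) (rho (A *m e i) s) - rho (A *m e i) (rho (e i) s)).
Proof.
move=> soA; rewrite /so_act (so_cl_comm hC soA) linearZ scale_lfunE linear_sum.
rewrite sum_lfunE; congr (_ *: _); apply: eq_bigr => i _.
by rewrite linearZ scale_lfunE linearB add_lfunE opp_lfunE /clmul -!clME.
Qed.

(** For the positive definite form, e_i is orthogonal, with adjoint
    - eps_i e_i; the twist by H absorbs the sign eps_i, so that the adjoint of
    rho(v) becomes - k rho(v) for all v. *)
Lemma inv_bilform_exists : exists2 b : bilform S, b \in inv_bilform iota pi &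
  forall s, (forall t, b s t = 0) -> s = 0.
Proof.
have [b [b_gt0 bI]] := posdef_invariant_exists.
have [H [k [kk H0 HE]]] := twist_exists.
pose c : bilform S := (b \o H)%VF; have cE s t : c s t = b (H s) t.
  by rewrite comp_lfunE.
have adjb i s t : c (rho (e i) s) t = - k * c s (rho (e i) t).
  rewrite !cE HE linearZ /= scale_lfunE -(bI i (rho _ _)) clmul_basis_sq.
  rewrite linearZ /= scale_lfunE scalerA; congr (_ * _).
  by rewrite mulrN -mulrA sgn_pq_sq mulr1.
have adj v s t : c (rho v s) t = - k * c s (rho v t).
  rewrite !(clmul_sum v) !linear_sum sum_lfunE mulr_sumr; apply: eq_bigr => i _.
  by rewrite !linearZ /= scale_lfunE adjb /GRing.scale /= mulrCA.
exists c; last first.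
  move=> s s0; apply: H0; apply: contraTeq isT => /b_gt0.
  by rewrite -cE s0 ltxx.
apply/asboolP => A soA s t; rewrite !so_actE // !linearZ.
rewrite !scale_lfunE !linear_sum.
rewrite sum_lfunE -scalerDr -big_split big1 ?scaler0 // => i _ /=.
rewrite !linearZ /= scale_lfunE -scalerDr !linearB /= add_lfunE opp_lfunE !adj.
by rewrite !mulrA !mulrNN kk !mul1r addrA subrK subrr scaler0.
Qed.

(** * Multiplications and equivariant maps to forms *)

(** A nondegenerate invariant form is an isomorphism from S to its dual. *)
Lemma inv_bilform_iso : exists2 b : bilform S, b \in inv_bilform iota pi &
  exists N : 'Hom('Hom(S, R^o), S), cancel b N /\ cancel N b.
Proof.
have [b bI b_nd] := inv_bilform_exists; exists b => //; exists b^-1%VF.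
have b0 : lker b == 0%VS.
  apply/lker0P => s t st; apply/eqP; rewrite -subr_eq0; apply/eqP/b_nd => u.
  by rewrite linearB /= add_lfunE opp_lfunE st subrr.
split; first exact: lker0_lfunK.
have bT : limg b = fullv.
  apply/eqP; rewrite eqEdim subvf /= limg_dim_eq; last first.
    by rewrite (eqP b0) capv0.
  by rewrite !dimvf /dim /= muln1.
by move=> f; rewrite limg_lfunVK // bT memvf.
Qed.

(** Composition of the values of a bilinear map V x S -> U with f : U -> W. *)
Definition postcomp (U W : vectType R) (f : 'Hom(U, W))
  (m : 'Hom(V, 'Hom(S, U)))
  : 'Hom(V, 'Hom(S, W)) := linfun (fun v => (f \o m v)%VF).

Lemma postcompE (U W : vectType R) (f : 'Hom(U, W)) m v s :
  postcomp f m v s = f (m v s).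
Proof.
rewrite linfunE ?comp_lfunE // => a u w; apply/lfunP => x.
by rewrite linearP !(add_lfunE, scale_lfunE, comp_lfunE) linearP.
Qed.

Lemma hom2_eq (U : vectType R) (m n : 'Hom(V, 'Hom(S, U))) :
  (forall v s, m v s = n v s) -> m = n.
Proof. by move=> mn; apply/lfunP => v; apply/lfunP. Qed.

Lemma postcomp_lin (U W : vectType R) (f : 'Hom(U, W)) : linear (postcomp f).
Proof.
move=> a m n; apply: hom2_eq => v s.
by rewrite !(add_lfunE, scale_lfunE, postcompE) linearP.
Qed.

(** A bilinear form on S is a map from S to its dual; an equivariant map from V
    to such forms, followed by the inverse of a nondegenerate
    invariant form S -> S^*, is an equivariant multiplication. *)
Lemma lin_isomorphic_JM : lin_isomorphic (spaceJ iota pi) (spaceM iota pi).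
Proof.
have [b /asboolP bI [N [bK NK]]] := inv_bilform_iso.
have bN A s t : so A -> b (act A s) t = - b s (act A t).
  by move=> soA; apply/eqP; rewrite -addr_eq0 bI.
have [|||||f [fbij _]] := @sub_lin_bij R _ _ _ _ (spaceJ iota pi)
  (spaceM iota pi) (postcomp N) (postcomp b); last by exists f.
- exact: postcomp_lin.
- move=> j /asboolP jE; apply/asboolP => A soA v s; rewrite !postcompE.
  apply: (can_inj bK); rewrite linearD /= !NK; apply/lfunP => t.
  by rewrite bN // NK add_lfunE jE // opprD addrAC addNr add0r.
- move=> m /asboolP mE; apply/asboolP => A soA v s t; rewrite !postcompE.
  by rewrite opprD -bN // mE // linearD /= add_lfunE addrCA addNr addr0.
- by move=> j _; apply: hom2_eq => v s; rewrite !postcompE NK.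
- by move=> m _; apply: hom2_eq => v s; rewrite !postcompE bK.
Qed.

Lemma j_rho_exists (i : 'I_(p + q)) :
  exists f : {linear spaceB iota pi -> spaceJ iota pi},
    bijective f /\ forall b, val (f b) = mulform (val b).
Proof.
apply: (@sub_lin_bij R _ _ _ _ (spaceB iota pi) (spaceJ iota pi) mulform
  (unmulform i)).
- exact: mulform_lin.
- exact: mulform_equiv.
- exact: unmulform_inv.
- by move=> b _; apply: mulformK.
- exact: unmulformK.
Qed.

End Module.

Theorem corollary1p6 (R : realType) (p q : nat) (hV : (0 < p + q)%N)
    (C : algType R) (iota : {linear 'cV[R]_(p + q) -> C})
    (hC : clifford_algebra iota)
    (S : vectType R) (pi : {linear C -> 'End(S)})
    (hS : spinor_module pi) :
  [/\ lin_isomorphic (spaceB iota pi) (spaceJ iota pi),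
      lin_isomorphic (spaceB iota pi) (spaceM iota pi),
      lin_isomorphic (spaceJ iota pi) (spaceM iota pi),
      (exists j_rho : {linear spaceB iota pi -> spaceJ iota pi},
         bijective j_rho /\
         forall (beta : spaceB iota pi) v s t,
           val (j_rho beta) v s t = val beta (clmul iota pi v s) t)
    & forall j : 'Hom('cV[R]_(p + q), bilform S),
        j \in equiv_bilform iota pi -> injective j ->
        exists2 beta : bilform S, beta \in inv_bilform iota pi &
          forall v s t, j v s t = beta (clmul iota pi v s) t].
Proof.
have [[clC _] [modS _]] := (hC, hS); pose i0 := Ordinal hV.
have [f [fbij fE]] := j_rho_exists clC modS i0.
have [g gbij] := lin_isomorphic_JM clC modS.
split.
- by exists f.
- by exists (g \o f : {linear _ -> _}); apply: bij_comp.
- by exists g.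
- by exists f; split=> // b v s t; rewrite fE mulformE.
- move=> j jE _; exists (unmulform iota pi i0 j); first exact: unmulform_inv.
  by move=> v s t; rewrite -mulformE unmulformK.
Qed.
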